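(* Let $m\ge2$ and let $Y_1,\dots,Y_m\in\mathbb{R}^{2n\times n}$ be frames. For every symplectic matrix $R\in Sp(2n)$, $$\mu_c^{\pm}(Y_1,\dots,Y_m)=\mu_c^{\pm}(R^{-1}Y_1,\dots,R^{-1}Y_m),\qquad \nu_c^{\pm}(Y_1,\dots,Y_m)=\nu_c^{\pm}(R^{-1}Y_1,\dots,R^{-1}Y_m).$$
   Context: $\mathcal{J}=\begin{pmatrix}0&I\\-I&0\end{pmatrix}\in\mathbb{R}^{2n\times 2n}$, $w(Y,\hat Y)=Y^T\mathcal{J}\hat Y$, $Sp(2n)=\{Z\in\mathbb{R}^{2n\times2n}: Z^T\mathcal{J}Z=\mathcal{J}\}$. For a real symmetric matrix $A$, $\operatorname{ind}A$ is the number of negative eigenvalues counted with multiplicity. $A^{\dagger}$ is the Moore–Penrose pseudoinverse. A frame is a real $2n\times n$ matrix $Y$ with $w(Y,Y)=0$ and $\operatorname{rank}Y=n$. For frames $Y=\binom{X}{U}$, $\hat Y=\binom{\hat X}{\hat U}$ ($n\times n$ blocks) put $\mathcal M=(I-X^{\dagger}X)\,w(Y,\hat Y)$, $\mathcal T=I-\mathcal M^{\dagger}\mathcal M$, $\mathcal P=\mathcal T\,w(Y,\hat Y)^T X^{\dagger}\hat X\,\mathcal T$ (symmetric), and define the comparative index and dual comparative index $\mu(Y,\hat Y)=\operatorname{rank}\mathcal M+\operatorname{ind}\mathcal P$, $\mu^*(Y,\hat Y)=\operatorname{rank}\mathcal M+\operatorname{ind}(-\mathcal P)$. Cyclic sums,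 $m\ge2$: $\mu_c^-(Y_1,\dots,Y_m)=\sum_{k=1}^{m-1}\mu(Y_k,Y_{k+1})+\mu(Y_m,Y_1)$, $\mu_c^+(Y_1,\dots,Y_m)=\sum_{k=1}^{m-1}\mu^*(Y_k,Y_{k+1})+\mu^*(Y_m,Y_1)$, $\nu_c^-(Y_1,\dots,Y_m)=\sum_{k=1}^{m-1}\mu(Y_k,Y_{k+1})-\mu(Y_1,Y_m)$, $\nu_c^+(Y_1,\dots,Y_m)=\sum_{k=1}^{m-1}\mu^*(Y_k,Y_{k+1})-\mu^*(Y_1,Y_m)$. *)

(* Defs.v *)
From mathcomp Require Import all_boot all_order all_algebra.
From mathcomp Require Import polyrcf.
From mathcomp Require Import reals.

Set Implicit Arguments.
Unset Strict Implicit.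
Unset Printing Implicit Defensive.

Import Order.TTheory GRing.Theory Num.Theory.

Local Open Scope ring_scope.

(* MathComp's [pinvmx] is only some partial inverse, not the Moore-Penrose
   one, so the latter is introduced here by the four Penrose equations. *)
Section MoorePenrose.
Context {R : realFieldType}.

Definition penrose m n (A : 'M[R]_(m, n)) (B : 'M[R]_(n, m)) : bool :=
  [&& A *m B *m A == A, B *m A *m B == B,
      (A *m B)^T == A *m B & (B *m A)^T == B *m A].

Lemma row_free_gram_unit m n (F : 'M[R]_(m, n)) :
  row_free F -> F *m F^T \in unitmx.
Proof.
move=> freeF; rewrite -row_free_unit; apply/inj_row_free => v vFF0.
apply: (row_free_inj freeF); rewrite mul0mx.
have: (v *m F) *m (v *m F)^T = 0 by rewrite trmx_mul !mulmxA -(mulmxA v) vFF0 mul0mx.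
move/matrixP/(_ 0 0); rewrite !mxE => /eqP.
rewrite psumr_eq0; last by move=> i _; rewrite !mxE -expr2 sqr_ge0.
move/allP => sq0; apply/rowP => j; have := sq0 j (mem_index_enum j).
by rewrite !mxE mulf_eq0 orbb => /eqP.
Qed.

Lemma penrose_exists m n (A : 'M[R]_(m, n)) : exists B, penrose A B.
Proof.
have GF := row_free_gram_unit (row_base_free A).
have GC : (col_base A)^T *m col_base A \in unitmx.
  have := @row_free_gram_unit _ _ (col_base A)^T.
  by rewrite trmxK; apply; rewrite /row_free mxrank_tr; apply: col_base_full.
move: (mulmx_base A) GF GC.
move: (col_base A) (row_base A); move: (\rank A) => r C F <- GF GC.
set P := F *m F^T in GF; set Q := C^T *m C in GC.
have trP : P^T = P by rewrite trmx_mul trmxK.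
have trQ : Q^T = Q by rewrite trmx_mul trmxK.
pose B := F^T *m invmx P *m invmx Q *m C^T.
have AB : C *m F *m B = C *m invmx Q *m C^T.
  by rewrite /B !mulmxA -(mulmxA C) -/P -(mulmxA C) mulmxV // mulmx1.
have BA : B *m (C *m F) = F^T *m invmx P *m F.
  rewrite /B !mulmxA -(mulmxA _ C^T C) -/Q -(mulmxA _ (invmx Q) Q).
  by rewrite mulVmx // mulmx1.
exists B; apply/and4P; split.
- by rewrite AB !mulmxA -(mulmxA _ C^T C) -/Q -(mulmxA _ (invmx Q) Q)
       mulVmx // mulmx1.
- by rewrite BA /B !mulmxA -(mulmxA _ F F^T) -/P -(mulmxA _ (invmx P) P)
       mulVmx // mulmx1.
- by rewrite AB !trmx_mul trmxK trmx_inv trQ mulmxA.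
- by rewrite BA !trmx_mul trmxK trmx_inv trP mulmxA.
Qed.

Definition pinv m n (A : 'M[R]_(m, n)) : 'M[R]_(n, m) :=
  xchoose (penrose_exists A).

Lemma pinvP m n (A : 'M[R]_(m, n)) : penrose A (pinv A).
Proof. exact: xchooseP. Qed.

Lemma penrose_uniq m n (A : 'M[R]_(m, n)) B C :
  penrose A B -> penrose A C -> B = C.
Proof.
case/and4P => /eqP B1 /eqP B2 /eqP B3 /eqP B4.
case/and4P => /eqP C1 /eqP C2 /eqP C3 /eqP C4.
have ABC : A *m B = A *m C.
  by rewrite -B3 -{1}C1 -(mulmxA (A *m C)) trmx_mul C3 B3 mulmxA B1.
have BAC : B *m A = C *m A.
  by rewrite -B4 -{1}C1 -(mulmxA A) mulmxA trmx_mul B4 C4 -mulmxA [A *m (B *m A)]mulmxA B1.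
by rewrite -B2 BAC -mulmxA ABC mulmxA.
Qed.

End MoorePenrose.

Section ComparativeIndex.
Context {R : rcfType}.

(* [char_poly A] is nonzero and [rootsR] lists its real roots without
   repetition; [mup x p] is the multiplicity of [x] as a root of [p]. *)
Definition ind n (A : 'M[R]_n) : nat :=
  \sum_(x <- rootsR (char_poly A) | x < 0) mup x (char_poly A).

Definition Jmx n : 'M[R]_(n + n) := block_mx 0 1%:M (- 1%:M) 0.

Definition symplectic n (Z : 'M[R]_(n + n)) : Prop := Z^T *m Jmx n *m Z = Jmx n.

Section Frames.
Variable n : nat.
Implicit Types Y Yh : 'M[R]_(n + n, n).

Definition wronskian Y Yh : 'M[R]_n := Y^T *m Jmx n *m Yh.

Definition frame Y : Prop := wronskian Y Y = 0 /\ \rank Y = n.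

Definition ciM Y Yh : 'M[R]_n :=
  (1%:M - pinv (usubmx Y) *m usubmx Y) *m wronskian Y Yh.

Definition ciT Y Yh : 'M[R]_n := 1%:M - pinv (ciM Y Yh) *m ciM Y Yh.

Definition ciP Y Yh : 'M[R]_n :=
  ciT Y Yh *m (wronskian Y Yh)^T *m pinv (usubmx Y) *m usubmx Yh *m ciT Y Yh.

Definition mu Y Yh : nat := (\rank (ciM Y Yh) + ind (ciP Y Yh))%N.

Definition mu_dual Y Yh : nat := (\rank (ciM Y Yh) + ind (- ciP Y Yh))%N.

(* A family Y_1, ..., Y_m is given by a function on nat; only its values at
   the indices 1, ..., m are used. *)
Implicit Types Ys : nat -> 'M[R]_(n + n, n).

Definition mu_c_minus m Ys : nat :=
  (\sum_(1 <= k < m) mu (Ys k) (Ys k.+1) + mu (Ys m) (Ys 1))%N.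

Definition mu_c_plus m Ys : nat :=
  (\sum_(1 <= k < m) mu_dual (Ys k) (Ys k.+1) + mu_dual (Ys m) (Ys 1))%N.

Definition nu_c_minus m Ys : int :=
  (\sum_(1 <= k < m) mu (Ys k) (Ys k.+1))%N%:Z - (mu (Ys 1%N) (Ys m))%:Z.

Definition nu_c_plus m Ys : int :=
  (\sum_(1 <= k < m) mu_dual (Ys k) (Ys k.+1))%N%:Z - (mu_dual (Ys 1%N) (Ys m))%:Z.

End Frames.
End ComparativeIndex.

(* Main.v *)
Require Import Defs.
From mathcomp Require Import all_boot all_order all_algebra.
From mathcomp Require Import polyrcf complex ring zify.
From mathcomp Require Import reals.

(** For a plane [W] transversal to the vertical plane [V] and to the Lagrangian
planes involved, each Lagrangian plane [Y] is a graph over [V] along [W], given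
by a symmetric matrix [A_Y].  The comparative index is then
  mu(Y, Z) = ind (A_Z - A_Y) + ind (- A_Z) - ind (- A_Y),
because the block form with rows (-A_Y, A_Z) and (A_Z, -A_Z) is congruent to
diag (A_Z - A_Y, - A_Z), while eliminating its first block produces exactly the
matrices M and P defining mu.  The term [A_Z - A_Y] depends only on the
symplectic products of [Y], [Z], [W], so mu(Y, Z) - mu(S^-1 Y, S^-1 Z) is a
difference g(Z) - g(Y), which disappears from both kinds of cyclic sums.  The
dual index reduces to mu through the antisymplectic map diag (1, -1). *)

Set Implicit Arguments.
Unset Strict Implicit.
Unset Printing Implicit Defensive.

Import Order.TTheory GRing.Theory Num.Theory.

Local Open Scope ring_scope.

(** * Spectral theorem for symmetric matrices over a real closed field *)

Section RealSpectral.
Variable R : rcfType.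

Lemma quad_ge0 n (v : 'rV[R]_n) : 0 <= (v *m v^T) 0 0.
Proof. by rewrite mxE sumr_ge0 // => i _; rewrite mxE -expr2 sqr_ge0. Qed.

Lemma quad_eq0 n (v : 'rV[R]_n) : ((v *m v^T) 0 0 == 0) = (v == 0).
Proof.
apply/idP/eqP => [|->]; last by rewrite mul0mx mxE.
rewrite mxE psumr_eq0 => [/allP v0|i _]; last by rewrite mxE -expr2 sqr_ge0.
apply/rowP => i; have := v0 i (mem_index_enum i).
by rewrite !mxE mulf_eq0 orbb => /eqP.
Qed.

(** Over [R[i]] the matrix is Hermitian, hence unitarily diagonalizable with real diagonal. The
    eigenvector found there is complex, so the descent to [R] goes through roots of the
    characteristic polynomial. *)
Lemma symmetric_eigenvalue n (A : 'M[R]_n.+1) : A^T = A ->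
  exists a, eigenvalue A a.
Proof.
move=> symA.
have hermA : map_mx (real_complex R) A \is hermsymmx.
  apply: realsym_hermsym.
    by apply/is_hermitianmxP; rewrite scale1r map_mx_id // map_trmx symA.
  by apply/mxOverP => i j; rewrite mxE complex_real.
have spA := orthomx_spectralP (hermitian_normalmx hermA).
have /mxOverP /(_ 0 0) spR := hermitian_spectral_diag_real hermA.
set P := spectralmx _ in spA; set d := spectral_diag _ in spA spR.
have Pu : P \in unitmx by apply: spectral_unit.
have dE : real_complex R (complex.Re (d 0 0)) = d 0 0 by apply: RRe_real.
exists (complex.Re (d 0 0)); rewrite eigenvalue_root_char.
rewrite -(fmorph_root (real_complex R)) map_char_poly -eigenvalue_root_char.
rewrite /= dE; apply/eigenvalueP; exists (row 0 P).
  rewrite -row_mul {1}spA !mulmxA mulmxV // mul1mx mul_diag_mx.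
  by apply/rowP => j; rewrite !mxE.
apply/eqP => P0; have := mul1mx (row 0 P); rewrite P0 => _.
have : delta_mx 0 0 *m P = (0 : 'rV_n.+1) by rewrite -rowE.
move/(congr1 (mulmx^~ (invmx P))); rewrite mulmxK // mul0mx.
by move/rowP/(_ 0)/eqP; rewrite !mxE oner_eq0.
Qed.

(* [H] is the Householder reflection exchanging [v] and the first basis vector. *)
Lemma orthogonal_first_row n (v : 'rV[R]_n.+1) : v *m v^T = 1%:M ->
  exists2 H : 'M[R]_n.+1, H *m H^T = 1%:M & row 0 H = v.
Proof.
move=> v1; pose e : 'rV[R]_n.+1 := delta_mx 0 0; pose u := e - v.
have [u0|u_neq0] := eqVneq u 0.
  exists 1%:M; first by rewrite trmx1 mulmx1.
  by rewrite row1; apply/eqP; rewrite -subr_eq0 -/e -/u u0.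
pose q := (u *m u^T) 0 0; have q_neq0 : q != 0 by rewrite quad_eq0.
have uu : u *m u^T = q%:M by rewrite -mx11_scalar.
have ee : e *m e^T = 1%:M.
  by rewrite trmx_delta mul_delta_mx; apply/matrixP => i j; rewrite !ord1 !mxE.
(* As [e] and [v] are unit vectors, both sides equal 2 - 2 e.v. *)
have eu : 2 *: (e *m u^T) = q%:M.
  have ev : v *m e^T = e *m v^T.
    by apply/matrixP => i j; rewrite !mxE; apply: eq_bigr => k _; rewrite !mxE !ord1 mulrC.
  rewrite -uu /u linearB /= mulmxBl !mulmxBr ee v1 ev opprB.
  by rewrite scaler_nat mulr2n.
have uE : e - u = v by rewrite subKr.
clearbody q u; pose H : 'M_n.+1 := 1%:M - (2 / q) *: (u^T *m u).
have HT : H^T = H by rewrite linearB linearZ /= trmx1 trmx_mul trmxK.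
exists H.
  have UU : u^T *m u *m (u^T *m u) = q *: (u^T *m u).
    by rewrite mulmxA -(mulmxA u^T u) uu mul_mx_scalar -scalemxAl.
  rewrite HT /H mulmxBl mul1mx mulmxBr mulmx1 -scalemxAl -scalemxAr UU !scalerA.
  have -> : 2 / q * (2 / q) * q = 2 / q + 2 / q by field.
  by rewrite scalerDl opprB addrK subrK.
rewrite rowE mulmxBr mulmx1 -scalemxAr mulmxA -/e.
have -> : e *m u^T = (q / 2)%:M.
  apply: (@scalerI _ _ 2); first by rewrite pnatr_eq0.
  by rewrite eu scale_scalar_mx mulrCA mulfV ?mulr1 // pnatr_eq0.
rewrite mul_scalar_mx scalerA.
have -> : 2 / q * (q / 2) = 1 by field.
by rewrite scale1r uE.
Qed.

(** Induction on the size: an orthogonal matrix whose first row is a unit eigenvector conjugates [A]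
    to a matrix with first row [a *: delta_mx 0 0]. Symmetry clears the first column too, and the
    remaining block is diagonalized by induction. *)
Lemma spectral_symmetric n (A : 'M[R]_n) : A^T = A ->
  exists P : 'M[R]_n, exists2 d : 'rV[R]_n, P *m P^T = 1%:M &
  P *m A *m P^T = diag_mx d.
Proof.
elim: n A => [|n IHn] A symA.
  by exists 1%:M, 0; apply/matrixP => -[].
have [a /eigenvalueP [v vA v_neq0]] := symmetric_eigenvalue symA.
pose q := (v *m v^T) 0 0.
have q_gt0 : 0 < q by rewrite lt_def quad_eq0 v_neq0 quad_ge0.
pose w := (Num.sqrt q)^-1 *: v.
have wA : w *m A = a *: w by rewrite -scalemxAl vA !scalerA mulrC.
have w1 : w *m w^T = 1%:M.
  rewrite linearZ /= -scalemxAl -scalemxAr scalerA [_ *m _]mx11_scalar -/q.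
  rewrite -invfM -expr2 sqr_sqrtr ?ltW // scale_scalar_mx mulVf //.
  by rewrite gt_eqF.
have [H HH Hw] := orthogonal_first_row w1.
have row0B : row 0 (H *m A *m H^T) = a *: delta_mx 0 0.
  rewrite !row_mul Hw wA -scalemxAl; congr (_ *: _).
  by rewrite -Hw -row_mul HH row1.
set B := H *m A *m H^T in row0B.
have symB : B^T = B by rewrite /B !trmx_mul trmxK symA mulmxA.
pose B' : 'M_(1 + n) := B.
have lE : lshift n (0 : 'I_1) = 0 :> 'I_(1 + n) by apply: val_inj.
have B0j (j : 'I_(1 + n)) : B' 0 j = a * (j == 0)%:R.
  have /rowP/(_ j) := row0B; rewrite [LHS]mxE => ->.
  by rewrite !mxE eqxx.
have Bi0 (i : 'I_(1 + n)) : B' i 0 = a * (i == 0)%:R.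
  by rewrite -B0j; have /matrixP/(_ i 0) := symB; rewrite [LHS]mxE => <-.
have B0 : B' = block_mx a%:M 0 0 (drsubmx B').
  rewrite -[LHS]submxK; congr block_mx; apply/matrixP => i j.
  - by rewrite !ord1 mxE [in LHS]mxE lE B0j mxE eqxx mulr1 mulr1n.
  - by rewrite !ord1 mxE [in LHS]mxE lE B0j mxE mulr0.
  - by rewrite !ord1 mxE [in LHS]mxE lE Bi0 mxE mulr0.
have symB' : (drsubmx B')^T = drsubmx B' by rewrite trmx_drsub symB.
have [P [d PP PB]] := IHn _ symB'.
pose H' : 'M_(1 + n) := H; pose A' : 'M_(1 + n) := A.
have HH' : H' *m H'^T = 1%:M := HH.
have HA' : H' *m A' *m H'^T = block_mx a%:M 0 0 (drsubmx B') := B0.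
(* The size is read as [1 + n], convertible to [n.+1], so that block matrices can serve as
   witnesses. *)
suff : exists P : 'M[R]_(1 + n), exists2 d : 'rV[R]_(1 + n), P *m P^T = 1%:M &
  P *m A' *m P^T = diag_mx d by [].
pose Q : 'M_(1 + n) := block_mx 1%:M 0 0 P.
exists (Q *m H'), (row_mx a%:M d).
  rewrite trmx_mul mulmxA -(mulmxA Q) HH' mulmx1 /Q tr_block_mx !trmx0 trmx1.
  by rewrite mulmx_block !(mulmx0, mul0mx, addr0, add0r, mulmx1) PP -scalar_mx_block.
rewrite trmx_mul !mulmxA -(mulmxA Q H') -(mulmxA Q) HA' /Q tr_block_mx !trmx0 trmx1.
rewrite !mulmx_block !(mulmx0, mul0mx, addr0, add0r, mulmx1, mul1mx) PB.
rewrite diag_mx_row; congr block_mx.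
by apply/matrixP => i j; rewrite !ord1 !mxE.
Qed.

End RealSpectral.

(** * Sylvester's law of inertia and additivity of the negative index *)

Section NegativeIndex.
Variable R : rcfType.

Lemma ind_prod_XsubC n (A : 'M[R]_n) (s : seq R) :
  char_poly A = \prod_(x <- s) ('X - x%:P) -> ind A = count (fun x => x < 0) s.
Proof.
move=> pA.
have -> : ind A = (\sum_(x <- rootsR (char_poly A) | (x < 0)%R) mup x (char_poly A))%N.
  by [].
rewrite -sum1_count -[RHS]big_undup_iterop_count.
have p_neq0 : char_poly A != 0 by rewrite monic_neq0 ?char_poly_monic.
have eq_roots : perm_eq (rootsR (char_poly A)) (undup s).
  apply: uniq_perm; rewrite ?undup_uniq ?uniq_roots // => x.
  by rewrite mem_undup -(roots_on_rootsR p_neq0) pA root_prod_XsubC.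
rewrite (perm_big _ eq_roots) /=; apply: eq_bigr => x _.
by rewrite pA mu_prod_XsubC Monoid.iteropE iter_addn_0 mul1n.
Qed.

Lemma char_poly_conj n (P Q A : 'M[R]_n) :
  P *m Q = 1%:M -> char_poly (P *m A *m Q) = char_poly A.
Proof.
move=> PQ; rewrite /char_poly /char_poly_mx !map_mxM.
set p := map_mx _ P; set q := map_mx _ Q; set a := map_mx _ A.
have pq : p *m q = 1%:M by rewrite -map_mxM PQ map_mx1.
have -> : 'X%:M - p *m a *m q = p *m ('X%:M - a) *m q.
  by rewrite mulmxBr mulmxBl mul_mx_scalar -scalemxAl pq scalemx1.
by rewrite !det_mulmx mulrC mulrA (mulrC (\det q)) -det_mulmx pq det1 mul1r.
Qed.

Lemma char_poly_diag n (d : 'rV[R]_n) :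
  char_poly (diag_mx d) = \prod_(x <- [seq d 0 i | i <- enum 'I_n]) ('X - x%:P).
Proof.
rewrite char_poly_trig ?diag_mx_is_trig // big_map enumT.
by apply: eq_bigr => i _; rewrite mxE eqxx.
Qed.

Lemma ind_spectral n (P A : 'M[R]_n) (d : 'rV[R]_n) :
  P *m P^T = 1%:M -> P *m A *m P^T = diag_mx d ->
  ind A = #|[pred i | d 0 i < 0]|.
Proof.
move=> PP PA.
have pA : char_poly A = char_poly (diag_mx d) by rewrite -PA char_poly_conj.
rewrite (ind_prod_XsubC (etrans pA (char_poly_diag d))) count_map.
by rewrite cardE size_filter enumT; apply: eq_count => i.
Qed.

Lemma char_poly_split n (A : 'M[R]_n) : A^T = A ->
  exists s : seq R, char_poly A = \prod_(x <- s) ('X - x%:P).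
Proof.
move=> /spectral_symmetric [P [d PP PA]].
by eexists; rewrite -(char_poly_conj _ PP) PA char_poly_diag.
Qed.

Definition negdef k (M : 'M[R]_k) : Prop :=
  forall v : 'rV_k, v != 0 -> (v *m M *m v^T) 0 0 < 0.

Lemma quad_diag n (d y : 'rV[R]_n) :
  (y *m diag_mx d *m y^T) 0 0 = \sum_i d 0 i * y 0 i ^+ 2.
Proof.
rewrite mul_mx_diag mxE; apply: eq_bigr => i _.
by rewrite !mxE mulrAC mulrC -expr2.
Qed.

(** The rows of [V] are the eigenvectors with negative eigenvalue. With [negdef_leq_ind] this makes
    [ind A] the largest dimension of a negative definite subspace. *)
Lemma ind_negdef n (A : 'M[R]_n) : A^T = A ->
  exists V : 'M[R]_(ind A, n), negdef (V *m A *m V^T).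
Proof.
move=> /spectral_symmetric [P [d PP PA]]; rewrite (ind_spectral PP PA).
pose f : 'I_#|[pred i | d 0 i < 0]| -> 'I_n := enum_val.
have fneg i : d 0 (f i) < 0 by have := enum_valP i; rewrite inE.
exists (rowsub f P) => v v_neq0.
have -> : rowsub f P *m A *m (rowsub f P)^T = diag_mx (colsub f d).
  rewrite trmx_mxsub mul_rowsub_mx -mxsub_mul PA.
  by apply/matrixP => i j; rewrite !mxE (inj_eq enum_val_inj).
rewrite quad_diag lt_neqAle; apply/andP; split; last first.
  by rewrite sumr_le0 // => i _; rewrite mxE mulr_le0_ge0 ?sqr_ge0 // ltW.
rewrite -oppr_eq0 -sumrN psumr_eq0 => [|i _].
  apply: contraNN v_neq0 => /allP v0; apply/eqP/rowP => i.
  have := v0 i (mem_index_enum i).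
  by rewrite !mxE oppr_eq0 mulf_eq0 lt_eqF //= sqrf_eq0 => /eqP.
by rewrite mxE oppr_ge0 mulr_le0_ge0 ?sqr_ge0 // ltW.
Qed.

(** A vector without components along the negative eigenvectors has a nonnegative quadratic value;
    hence projecting the rows of [V] onto those eigenvectors is injective. *)
Lemma negdef_leq_ind n k (A : 'M[R]_n) (V : 'M[R]_(k, n)) : A^T = A ->
  negdef (V *m A *m V^T) -> (k <= ind A)%N.
Proof.
move=> /spectral_symmetric [P [d PP PA]] negV; rewrite (ind_spectral PP PA).
pose f : 'I_#|[pred i | d 0 i < 0]| -> 'I_n := enum_val.
suff freeV : row_free (V *m P^T *m (rowsub f 1%:M)^T).
  by rewrite -{1}(eqP freeV) rank_leq_col.
apply/inj_row_free => v; rewrite !mulmxA; set y := v *m V *m P^T => yf0.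
apply/eqP; have [//|/negV] := eqVneq v 0; rewrite ltNge => /negP[].
have -> : v *m (V *m A *m V^T) *m v^T = y *m diag_mx d *m y^T.
  have PP' := mulmx1C PP.
  rewrite -PA /y !trmx_mul trmxK !mulmxA.
  by rewrite -!(mulmxA _ P^T P) PP' !mulmx1.
rewrite quad_diag sumr_ge0 // => i _.
have [d_ge0|d_lt0] := leP 0 (d 0 i); first by rewrite mulr_ge0 ?sqr_ge0.
have i_neg : i \in [pred i | d 0 i < 0] by [].
move/rowP/(_ (enum_rank_in i_neg i)): yf0.
rewrite trmx_mxsub trmx1 mulmx_colsub mulmx1 !mxE /f enum_rankK_in //.
by move=> ->; rewrite expr0n mulr0.
Qed.

(** If [V] is negative definite for the compressed form, then [V *m C] is so for [A]. Rectangular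
    and singular [C] are allowed, which later gives inequalities from one-sided inverses and
    projectors. *)
Lemma ind_congr_le m n (C : 'M[R]_(m, n)) (A : 'M[R]_n) : A^T = A ->
  (ind (C *m A *m C^T) <= ind A)%N.
Proof.
move=> symA; have [|V negV] := @ind_negdef _ (C *m A *m C^T).
  by rewrite !trmx_mul trmxK symA mulmxA.
by apply: (negdef_leq_ind (V := V *m C) symA); rewrite trmx_mul; rewrite !mulmxA in negV *.
Qed.

Lemma ind_congr n (C A : 'M[R]_n) : A^T = A -> C \in unitmx ->
  ind (C *m A *m C^T) = ind A.
Proof.
move=> symA Cu; apply/eqP; rewrite eqn_leq (ind_congr_le C symA) andTb.
have symC : (C *m A *m C^T)^T = C *m A *m C^T.
  by rewrite !trmx_mul trmxK symA mulmxA.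
have := ind_congr_le (invmx C) symC.
by rewrite !mulmxA (mulVmx Cu) mul1mx -mulmxA -trmx_mul (mulVmx Cu) trmx1 mulmx1.
Qed.

Lemma ind_block_diag m n (A : 'M[R]_m) (B : 'M[R]_n) : A^T = A -> B^T = B ->
  ind (block_mx A 0 0 B) = (ind A + ind B)%N.
Proof.
move=> /char_poly_split [s As] /char_poly_split [t Bt].
rewrite (ind_prod_XsubC As) (ind_prod_XsubC Bt) -count_cat.
apply: ind_prod_XsubC; rewrite big_cat /= -As -Bt /char_poly.
by rewrite char_block_diag_mx det_ublock.
Qed.

(** The sum is the compression of diag(A, B) by the row (1 1). *)
Lemma ind_add_le n (A B : 'M[R]_n) : A^T = A -> B^T = B ->
  (ind (A + B) <= ind A + ind B)%N.
Proof.
move=> symA symB; rewrite -ind_block_diag //.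
have symAB : (block_mx A 0 0 B)^T = block_mx A 0 0 B.
  by rewrite tr_block_mx !trmx0 symA symB.
have := ind_congr_le (row_mx 1%:M 1%:M) symAB.
rewrite tr_row_mx trmx1 mul_row_block mul_row_col !(mul1mx, mulmx1, mulmx0).
by rewrite addr0 add0r.
Qed.

Lemma ind_scalar n (a : R) : ind (a%:M : 'M[R]_n) = if a < 0 then n else 0%N.
Proof.
have := @ind_spectral n 1%:M a%:M (const_mx a).
rewrite trmx1 !mulmx1 !mul1mx diag_const_mx => -> //.
by case: ifP => a0; [rewrite -[RHS]card_ord|rewrite -(card0 'I_n)];
  apply: eq_card => i; rewrite !inE mxE.
Qed.

(** A full rank factorization of [M] reduces the form to the hyperbolic form [K] on twice the
    rank. *)
Lemma ind_antidiag m n (M : 'M[R]_(m, n)) :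
  ind (block_mx 0 M M^T 0) = \rank M.
Proof.
set r := \rank M; pose K : 'M[R]_(r + r) := block_mx 0 1%:M 1%:M 0.
have symK : K^T = K by rewrite /K tr_block_mx !trmx0 trmx1.
have indK : ind K = r.
  (* Its rows combine the two isotropic halves of [K] into vectors of square 1 and -1. *)
  pose L : 'M[R]_(r + r) := block_mx 1%:M (2^-1)%:M 1%:M (- 2^-1)%:M.
  have LKL : L *m K *m L^T = block_mx 1%:M 0 0 (-1)%:M.
    rewrite /L /K tr_block_mx !tr_scalar_mx !mulmx_block.
    rewrite !(mulmx0, mul0mx, mulmx1, mul1mx, addr0, add0r) -!(raddfD (@scalar_mx R r)) /=.
    have h2 : 2^-1 + 2^-1 = 1 :> R by field.
    by rewrite h2 subrr addNr -opprD h2 raddf0.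
  have Lu : L \in unitmx.
    have : (L *m K *m L^T) *m block_mx 1%:M 0 0 (-1)%:M = 1%:M.
      rewrite LKL mulmx_block !(mulmx0, mul0mx, mulmx1, mul1mx, addr0, add0r).
      by rewrite -scalar_mxM mulrNN mulr1 -scalar_mx_block.
    by rewrite -!mulmxA => /mulmx1_unit [].
  rewrite -(ind_congr symK Lu) LKL ind_block_diag ?tr_scalar_mx // !ind_scalar.
  by rewrite ltr10 oppr_lt0 ltr01.
have freeF := row_base_free M; have fullC := col_base_full M.
have freeC : row_free (col_base M)^T by rewrite /row_free mxrank_tr.
have MCF := mulmx_base M; rewrite -/r in freeF freeC MCF.
move: (col_base M) (row_base M) freeC freeF MCF => C F freeC freeF MCF.
pose D := block_mx C 0 0 F^T.
have DKD : D *m K *m D^T = block_mx 0 M M^T 0.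
  rewrite /D /K tr_block_mx !trmx0 !mulmx_block trmxK.
  rewrite !(mulmx0, mul0mx, mulmx1, mul1mx, addr0, add0r).
  by rewrite -trmx_mul MCF.
have le1 := ind_congr_le D symK; rewrite indK in le1.
apply/eqP; rewrite -DKD eqn_leq le1 andTb.
(* [D] has full column rank; this left inverse recovers [K] from the block matrix and gives the
   reverse inequality. *)
pose D' := block_mx (pinvmx C^T)^T 0 0 (pinvmx F)^T.
have D'D : D' *m D = 1%:M.
  rewrite /D' /D mulmx_block !(mulmx0, mul0mx, addr0, add0r).
  by rewrite -{2}[C]trmxK -!trmx_mul !mulmxVp // !trmx1 -scalar_mx_block.
have symM : (D *m K *m D^T)^T = D *m K *m D^T.
  by rewrite !trmx_mul trmxK symK mulmxA.
have := ind_congr_le D' symM.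
by rewrite !mulmxA D'D mul1mx -mulmxA -trmx_mul D'D trmx1 mulmx1 indK.
Qed.

Lemma pinv_sym n (A : 'M[R]_n) : A^T = A -> (pinv A)^T = pinv A.
Proof.
move=> symA; apply: (@penrose_uniq _ _ _ A); last exact: pinvP.
have := pinvP A; move: (pinv A) => B /and4P [/eqP A1 /eqP A2 /eqP A3 /eqP A4].
have BA : A *m B^T = B *m A by rewrite -[RHS]A4 trmx_mul symA.
have AB : B^T *m A = A *m B by rewrite -[RHS]A3 trmx_mul symA.
apply/and4P; split; apply/eqP.
- by rewrite -[RHS]symA -[in RHS]A1 !trmx_mul symA mulmxA.
- by rewrite -[in RHS]A2 !trmx_mul symA mulmxA.
- by rewrite BA.
- by rewrite AB.
Qed.

Lemma pinv_symC n (A : 'M[R]_n) : A^T = A -> A *m pinv A = pinv A *m A.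
Proof.
move=> symA; have /and4P [_ _ /eqP <- _] := pinvP A.
by rewrite trmx_mul pinv_sym // symA.
Qed.

(** One inequality is subadditivity. For the other, stacking the orthogonal projectors onto the
    ranges of [A] and [B] compresses [A + B] to diag(A, B). *)
Lemma ind_add_orth n (A B : 'M[R]_n) : A^T = A -> B^T = B -> A *m B = 0 ->
  ind (A + B) = (ind A + ind B)%N.
Proof.
move=> symA symB AB; apply/eqP; rewrite eqn_leq ind_add_le //=.
have BA : B *m A = 0 by apply: trmx_inj; rewrite trmx_mul symA symB AB trmx0.
have /and4P [/eqP A1 _ /eqP A3 /eqP A4] := pinvP A.
have /and4P [/eqP B1 _ /eqP B3 /eqP B4] := pinvP B.
rewrite -ind_block_diag //.
pose p := A *m pinv A; pose q := B *m pinv B.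
have Ap : A *m p = A by rewrite /p pinv_symC // mulmxA.
have Bq : B *m q = B by rewrite /q pinv_symC // mulmxA.
have Bp : B *m p = 0 by rewrite /p mulmxA BA mul0mx.
have Aq : A *m q = 0 by rewrite /q mulmxA AB mul0mx.
have symAB : (A + B)^T = A + B by rewrite linearD /= symA symB.
have := ind_congr_le (col_mx p q) symAB.
rewrite tr_col_mx A3 B3 -mulmxA mul_mx_row !mulmxDl Ap Bp Aq Bq addr0 add0r.
rewrite mul_col_row.
have -> : p *m A = A by [].
have -> : q *m B = B by [].
have -> : p *m B = 0 by rewrite /p pinv_symC // -mulmxA AB mulmx0.
by have -> : q *m A = 0 by rewrite /q pinv_symC // -mulmxA BA mulmx0.
Qed.

End NegativeIndex.

(** * Index of a symmetric block matrix by generalized Schur complement *)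

Section Haynsworth.
Variable R : rcfType.

Lemma lower_unimodular_unit p q (H : 'M[R]_(q, p)) :
  block_mx 1%:M 0 H 1%:M \in unitmx.
Proof. by rewrite unitmxE det_lblock !det1 mulr1 unitr1. Qed.

(* Haynsworth's inertia additivity, with a possibly singular [E]. *)
Lemma ind_block p q (E : 'M[R]_p) (F : 'M[R]_(p, q)) (G : 'M[R]_q) :
    E^T = E -> G^T = G ->
    let M := (1%:M - pinv E *m E) *m F in
    let T := 1%:M - pinv M *m M in
  ind (block_mx E F F^T G) =
  (ind E + (\rank M + ind (T *m (G - F^T *m pinv E *m F) *m T)))%N.
Proof.
move=> symE symG M T.
have symQ : (block_mx E F F^T G)^T = block_mx E F F^T G.
  by rewrite tr_block_mx symE symG trmxK.
have /and4P [/eqP E1 /eqP E2 _ _] := pinvP E.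
have symE' := pinv_sym symE; have EC := pinv_symC symE.
move: (pinv E) @M @T E1 E2 symE' EC => e M T E1 E2 symE' EC.
have /and4P [/eqP M1 /eqP M2 /eqP M3 /eqP M4] := pinvP M.
move: (pinv M) @T M1 M2 M3 M4 => m T M1 M2 M3 M4.
pose G1 := G - F^T *m e *m F; rewrite -/G1.
have symG1 : G1^T = G1.
  by rewrite linearB /= symG !trmx_mul trmxK symE' mulmxA.
have MT : M^T = F^T - F^T *m e *m E.
  by rewrite /M trmx_mul linearB /= trmx1 trmx_mul symE symE' mulmxBr mulmx1 EC mulmxA.
have ME : M^T *m E = 0.
  by rewrite MT mulmxBl -mulmxA -EC -(mulmxA F^T) E1 subrr.
have EM : E *m M = 0 by apply: trmx_inj; rewrite trmx_mul symE ME trmx0.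
have Me : M^T *m e = 0 by rewrite MT mulmxBl -!mulmxA (mulmxA e) E2 subrr.
have mE : m *m E = 0.
  by rewrite -M2 -(mulmxA m M) -M3 trmx_mul -!mulmxA ME !mulmx0.
(* First elimination: a singular [E] removes from [F] only the part in its range, leaving [M]. *)
pose S1 := block_mx 1%:M 0 (- (F^T *m e)) 1%:M : 'M[R]_(p + q).
have Q1 : S1 *m block_mx E F F^T G *m S1^T = block_mx E M M^T G1.
  rewrite /S1 tr_block_mx !trmx0 !trmx1 linearN /= trmx_mul trmxK symE'.
  rewrite !mulmx_block !(mul1mx, mulmx1, mul0mx, mulmx0, addr0, add0r).
  rewrite !mulNmx !mulmxN -[- _ + F^T]addrC -MT -[M^T *m _]/(M^T *m _).
  rewrite (mulmxA M^T) Me mul0mx oppr0 add0r mulmxA EC -/G1.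
  rewrite [_ + F]addrC [- _ + G]addrC -/G1.
  by rewrite /M mulmxBl mul1mx.
clearbody G1; pose h : R := 2^-1.
pose P := m *m M; have symP : P^T = P by exact: M4.
have PE : m *m M = P by []; clearbody P.
(* [H *m M] and its transpose must add up to P G1 P - G1 P - P G1; the factor 1/2 shares the
   symmetric term between them. *)
pose H := - ((G1 - h *: (P *m G1)) *m m).
have HE : H *m E = 0 by rewrite mulNmx -mulmxA mE mulmx0 oppr0.
have HM : H *m M = h *: (P *m G1 *m P) - G1 *m P.
  have -> : H *m M = - ((G1 - h *: (P *m G1)) *m P) by rewrite mulNmx -mulmxA PE.
  by rewrite mulmxBl -scalemxAl opprB.
have HMT : M^T *m H^T = h *: (P *m G1 *m P) - P *m G1.
  by rewrite -trmx_mul HM linearB linearZ /= !trmx_mul symP symG1 mulmxA.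
(* Adding multiples of [M] removes from [G1] all that [T] does not see. *)
have Q2 : block_mx 1%:M 0 H 1%:M *m block_mx E M M^T G1 *m (block_mx 1%:M 0 H 1%:M)^T
    = block_mx E M M^T (T *m G1 *m T).
  rewrite tr_block_mx !trmx0 !trmx1.
  rewrite !mulmx_block !(mul1mx, mulmx1, mul0mx, mulmx0, addr0, add0r) HE add0r.
  have -> : E *m H^T = 0 by apply: trmx_inj; rewrite trmx_mul trmxK symE HE trmx0.
  rewrite add0r HM HMT; congr block_mx.
  rewrite /T PE mulmxBl mul1mx mulmxBr mulmx1 mulmxBl.
  have h2 : h + h = 1 by rewrite /h; field.
  have aa : P *m G1 *m P = h *: (P *m G1 *m P) + h *: (P *m G1 *m P).
    by rewrite -scalerDl h2 scale1r.
  rewrite [in RHS]aa; set a := h *: _; set b := P *m G1; set c := G1 *m P.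
  by apply/matrixP => i j; move: a b c => a b c; rewrite !mxE; ring.
rewrite -(ind_congr symQ (lower_unimodular_unit (- (F^T *m e)))) -/S1 Q1.
have symQ1 : (block_mx E M M^T G1)^T = block_mx E M M^T G1.
  by rewrite tr_block_mx symE symG1 trmxK.
rewrite -(ind_congr symQ1 (lower_unimodular_unit H)) Q2.
have MT0 : M *m T = 0 by rewrite mulmxBr mulmx1 mulmxA M1 subrr.
have symT : T^T = T by rewrite linearB /= trmx1 M4.
set N := T *m G1 *m T.
have symN : N^T = N by rewrite !trmx_mul symT symG1 mulmxA.
(* The two summands multiply to 0, by [EM] and by [MT0], so their indices add. *)
have -> : block_mx E M M^T N = block_mx E 0 0 N + block_mx 0 M M^T 0.
  by rewrite add_block_mx !addr0 !add0r.
rewrite ind_add_orth.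
- by rewrite ind_block_diag // ind_antidiag addnAC addnA.
- by rewrite tr_block_mx !trmx0 symE symN.
- by rewrite tr_block_mx !trmx0 trmxK.
have NM : N *m M^T = 0 by rewrite -mulmxA -{2}symT -trmx_mul MT0 trmx0 mulmx0.
by rewrite mulmx_block !(mulmx0, mul0mx, addr0, add0r) EM NM -block_mx0.
Qed.

End Haynsworth.

(** * The comparative index as a difference of negative indices *)

Section MuIndex.
Variable R : rcfType.

(** Both sides are the orthogonal projector onto the row space shared by [X] and [E]. *)
Lemma pinv_proj p q n (X : 'M[R]_(p, n)) (E : 'M[R]_(q, n)) U V :
  X = U *m E -> E = V *m X -> pinv X *m X = pinv E *m E.
Proof.
move=> XU EV; have /and4P [/eqP X1 _ _ /eqP X4] := pinvP X.
have /and4P [/eqP E1 _ _ /eqP E4] := pinvP E.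
have pq : pinv X *m X *m (pinv E *m E) = pinv X *m X.
  by rewrite -mulmxA {2}XU -(mulmxA U) (mulmxA E) E1 -XU.
have qp : pinv E *m E *m (pinv X *m X) = pinv E *m E.
  by rewrite -mulmxA {2}EV -(mulmxA V) (mulmxA X) X1 -EV.
by rewrite -pq -X4 -E4 -trmx_mul qp E4.
Qed.

Lemma mu_index n (Y Z : 'M[R]_(n + n, n)) (a b k A B : 'M[R]_n) :
    A^T = A -> B^T = B -> a \in unitmx -> b \in unitmx -> k \in unitmx ->
    usubmx Y = k *m A *m a^T -> usubmx Z = k *m B *m b^T ->
    wronskian Y Z = a *m (B - A) *m b^T ->
  (mu Y Z + ind (- A) = ind (B - A) + ind (- B))%N.
Proof.
move=> symA symB au bu ku YE ZE wE.
have symNA : (- A)^T = - A by rewrite linearN /= symA.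
have symNB : (- B)^T = - B by rewrite linearN /= symB.
have symBA : (B - A)^T = B - A by rewrite linearB /= symA symB.
pose E := a *m (- A) *m a^T; pose F := a *m B *m b^T; pose G := b *m (- B) *m b^T.
have symE : E^T = E by rewrite !trmx_mul trmxK symNA mulmxA.
have symG : G^T = G by rewrite !trmx_mul trmxK symNB mulmxA.
have indE : ind E = ind (- A) by apply: ind_congr.
have indQ : ind (block_mx E F F^T G) = (ind (B - A) + ind (- B))%N.
  rewrite -(ind_block_diag symBA symNB); set Q := block_mx (B - A) 0 0 (- B).
  have symQ : Q^T = Q by rewrite /Q tr_block_mx !trmx0 symBA symNB.
  (* This congruence carries diag(B - A, -B) to the form with blocks [E], [F], [G], whose index
     [ind_block] then computes a second time. *)
  pose D := block_mx a (- a) 0 b.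
  have Du : D \in unitmx by rewrite unitmxE det_ublock unitrM -!unitmxE au bu.
  rewrite -(ind_congr symQ Du); congr ind.
  rewrite /D /Q tr_block_mx trmx0 linearN /= !mulmx_block.
  rewrite !(mulmx0, mul0mx, addr0, add0r) !mulNmx !(mulmxN, mulNmx) !opprK.
  rewrite /E /F /G !(mulmxN, mulNmx) !trmx_mul trmxK symB !mulmxA.
  by rewrite mulmxBr mulmxBl addrAC subrr add0r.
have H := ind_block F symE symG.
rewrite -indQ H indE [RHS]addnC; apply/eqP; rewrite eqn_add2r; apply/eqP.
clear H indE indQ symNA symNB.
set X := usubmx Y; have XE : pinv X *m X = pinv E *m E.
  apply: (@pinv_proj _ _ _ X E (- (k *m invmx a)) (- (a *m invmx k))).
    by rewrite /E /X YE !(mulmxN, mulNmx) opprK -!mulmxA mulKmx.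
  by rewrite /E /X YE !(mulmxN, mulNmx) -!mulmxA mulKmx.
have /and4P [/eqP E1 /eqP E2 _ _] := pinvP E.
have symE' := pinv_sym symE; have EC := pinv_symC symE.
(* The Wronskian differs from [F] by [a *m A *m b^T]; since the projector kills this term, [ciM Y Z]
   is the matrix [M] of [ind_block]. *)
have KaA : (1%:M - pinv E *m E) *m (a *m A) = 0.
  set K := 1%:M - _; have KE : K *m E = 0 by rewrite mulmxBl mul1mx -EC E1 subrr.
  have atu : a^T \in unitmx by rewrite unitmx_tr.
  clearbody K; apply: (can_inj (mulmxK atu)); apply: oppr_inj.
  by rewrite mul0mx oppr0 -KE /E !(mulmxN, mulNmx) !mulmxA.
have wF : wronskian Y Z = F - a *m A *m b^T by rewrite wE mulmxBr mulmxBl.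
have ME : ciM Y Z = (1%:M - pinv E *m E) *m F.
  by rewrite /ciM -/X XE wF [LHS]mulmxBr (mulmxA _ (a *m A)) KaA mul0mx subr0.
have EE : E = - (a *m A *m a^T) by rewrite /E !(mulmxN, mulNmx).
have FE : F = a *m B *m b^T by [].
have GE : G = - (b *m B *m b^T) by rewrite /G !(mulmxN, mulNmx).
clearbody E F G; rewrite /mu ME.
suff -> : ciP Y Z = let M := (1%:M - pinv E *m E) *m F in
    let T := 1%:M - pinv M *m M in T *m (G - F^T *m pinv E *m F) *m T by [].
rewrite /ciP /ciT ME -/X /=; set M := (1%:M - pinv E *m E) *m F; set T := 1%:M - pinv M *m M.
have /and4P [/eqP M1 _ _ _] := pinvP M.
have MT : M *m T = 0 by rewrite mulmxBr mulmx1 mulmxA M1 subrr.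
have MF : M = F - pinv E *m E *m F by rewrite /M [LHS]mulmxBl mul1mx.
(* [M *m T = 0] puts the columns of [F *m T] in the range of [E], so [z] solves [E *m z = F *m T].
   Cancelling [a] expresses the upper block of [Z] through that of [Y], whence
   [pinv X *m usubmx Z *m T = - z] and [ciP] is the compressed Schur complement. *)
clearbody T; clearbody M; pose z := pinv E *m F *m T.
have Ez : E *m z = F *m T.
  move/eqP: MT; rewrite MF mulmxBl subr_eq0 => /eqP ->.
  by rewrite /z !mulmxA EC.
have zE : pinv E *m E *m z = z by rewrite /z !mulmxA E2.
have zdef : z = pinv E *m F *m T by [].
clearbody z; have Az : A *m a^T *m z = - (B *m b^T *m T).
  by apply: (can_inj (mulKmx au)); rewrite mulmxN !mulmxA -FE -Ez EE mulNmx opprK.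
have Zz : pinv X *m usubmx Z *m T = - z.
  rewrite ZE -!mulmxA.
  have -> : B *m (b^T *m T) = - (A *m a^T *m z) by rewrite Az opprK !mulmxA.
  have -> : k *m - (A *m a^T *m z) = - (X *m z).
    by rewrite mulmxN /X YE !mulmxA.
  by rewrite mulmxN mulmxA XE zE.
have wT : (wronskian Y Z)^T = F^T - b *m A *m a^T.
  by rewrite wF linearB /= !trmx_mul trmxK symA mulmxA.
have -> : T *m (wronskian Y Z)^T *m pinv X *m usubmx Z *m T =
    T *m ((wronskian Y Z)^T *m (pinv X *m usubmx Z *m T)) by rewrite !mulmxA.
rewrite Zz wT mulmxN mulmxBl -(mulmxA _ _ z) -(mulmxA b) (mulmxA A) Az.
rewrite !(mulmxN, mulNmx) opprK mulmxDr opprD zdef GE.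
by rewrite [in RHS]mulmxBr [in RHS]mulmxBl !(mulmxN, mulNmx) addrC !mulmxA.
Qed.

End MuIndex.

(** * Lagrangian planes as graphs, and planes transversal to finitely many frames *)

Section Wronskian.
Variables (R : rcfType) (n : nat).
Implicit Types V W Y Z : 'M[R]_(n + n, n).

Lemma trmx_Jmx : (Jmx n)^T = - Jmx n :> 'M[R]_(n + n).
Proof.
by rewrite /Jmx tr_block_mx !trmx0 trmx1 linearN /= trmx1 opp_block_mx !oppr0 opprK.
Qed.

Lemma wronskianE Y Z :
  wronskian Y Z = (usubmx Y)^T *m dsubmx Z - (dsubmx Y)^T *m usubmx Z.
Proof.
rewrite /wronskian /Jmx -{1}[Y]vsubmxK -{1}[Z]vsubmxK.
rewrite tr_col_mx mul_row_block mul_row_col.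
by rewrite !mulmx0 add0r addr0 mulmx1 mulmxN mulmx1 mulNmx addrC.
Qed.

Lemma wronskian_tr Y Z : (wronskian Y Z)^T = - wronskian Z Y.
Proof. by rewrite /wronskian !trmx_mul trmxK trmx_Jmx mulNmx mulmxN mulmxA. Qed.

Lemma wronskianDl Y1 Y2 Z :
  wronskian (Y1 + Y2) Z = wronskian Y1 Z + wronskian Y2 Z.
Proof. by rewrite /wronskian linearD /= !mulmxDl. Qed.

Lemma wronskianDr Y Z1 Z2 :
  wronskian Y (Z1 + Z2) = wronskian Y Z1 + wronskian Y Z2.
Proof. by rewrite /wronskian mulmxDr. Qed.

Lemma wronskianNr Y Z : wronskian Y (- Z) = - wronskian Y Z.
Proof. by rewrite /wronskian mulmxN. Qed.

Lemma wronskianMl Y Z (c : 'M[R]_n) :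
  wronskian (Y *m c) Z = c^T *m wronskian Y Z.
Proof. by rewrite /wronskian trmx_mul !mulmxA. Qed.

Lemma wronskianMr Y Z (c : 'M[R]_n) :
  wronskian Y (Z *m c) = wronskian Y Z *m c.
Proof. by rewrite /wronskian !mulmxA. Qed.

(** The Gram matrix of the columns of [V] and [W] is antidiagonal with invertible blocks, so these
    columns form a basis and nondegeneracy applies. *)
Lemma wronskian_unit_inj V W Y :
    wronskian V V = 0 -> wronskian W W = 0 -> wronskian V W \in unitmx ->
  wronskian V Y = 0 -> wronskian W Y = 0 -> Y = 0.
Proof.
move=> VV WW cu VY WY.
pose P : 'M[R]_(n + n) := row_mx V W.
have gram : P^T *m Jmx n *m P =
    block_mx 0 (wronskian V W) (- (wronskian V W)^T) 0.
  rewrite /P tr_row_mx mul_col_mx mul_col_row -!/(wronskian _ _) VV WW.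
  by rewrite wronskian_tr opprK.
move: (wronskian V W) cu gram => c cu gram.
pose G := block_mx 0 (- (invmx c)^T) (invmx c) 0.
have PJu : P^T *m Jmx n \in unitmx.
  have : P^T *m Jmx n *m (P *m G) = 1%:M.
    rewrite mulmxA gram /G mulmx_block !(mulmx0, mul0mx, addr0, add0r).
    rewrite mulmxV // mulNmx mulmxN opprK -trmx_mul mulVmx // trmx1.
    by rewrite -scalar_mx_block.
  by move/mulmx1_unit => [].
apply: (can_inj (mulKmx PJu)); rewrite mulmx0 /P tr_row_mx !mul_col_mx.
by rewrite -!/(wronskian _ _) VY WY col_mx0.
Qed.

(* Lagrangian planes transversal to [W] are graphs over [V] along [W]; this is
   the symmetric matrix of the graph of [Y]. *)
Definition slope V W Y : 'M[R]_n :=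
  invmx (wronskian V W) *m wronskian V Y *m (invmx (wronskian Y W))^T.

(** The difference of the two sides has zero Wronskian with both [V] and [W]. *)
Lemma slope_graph V W Y :
    wronskian V V = 0 -> wronskian W W = 0 ->
    wronskian V W \in unitmx -> wronskian Y W \in unitmx ->
  Y *m (invmx (wronskian Y W))^T =
  V *m (invmx (wronskian V W))^T + W *m slope V W Y.
Proof.
move=> VV WW cu au; apply/eqP; rewrite -subr_eq0; apply/eqP.
apply: (wronskian_unit_inj VV WW cu);
  rewrite wronskianDr wronskianNr wronskianDr !wronskianMr ?VV ?WW !mul0mx.
  rewrite add0r /slope; move: (wronskian V W) cu (wronskian V Y) => c cu d.
  by rewrite -!mulmxA mulKVmx // subrr.
rewrite addr0 -[wronskian W Y]opprK -[wronskian W V]opprK -!wronskian_tr.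
by rewrite !mulNmx -!trmx_mul !mulVmx // subrr.
Qed.

(** Inserting the graph forms, the isotropy of [V] and [W] leaves only the cross terms. The
    transpose stays because symmetry of the slope is deduced from the case [Z = Y]. *)
Lemma slope_diff V W Y Z :
    wronskian V V = 0 -> wronskian W W = 0 -> wronskian V W \in unitmx ->
    wronskian Y W \in unitmx -> wronskian Z W \in unitmx ->
  invmx (wronskian Y W) *m wronskian Y Z *m (invmx (wronskian Z W))^T =
  slope V W Z - (slope V W Y)^T.
Proof.
move=> VV WW cu au bu.
have -> : invmx (wronskian Y W) *m wronskian Y Z *m (invmx (wronskian Z W))^T =
    wronskian (Y *m (invmx (wronskian Y W))^T) (Z *m (invmx (wronskian Z W))^T).
  by rewrite wronskianMl wronskianMr trmxK mulmxA.
rewrite (slope_graph VV WW cu au) (slope_graph VV WW cu bu) wronskianDl !wronskianDr !wronskianMl !wronskianMr.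
rewrite VV WW trmxK !(mul0mx, mulmx0, addr0, add0r) mulmxA mulVmx // mul1mx.
rewrite -[wronskian W V]opprK -wronskian_tr mulNmx mulmxN -trmx_mul.
by rewrite mulVmx // trmx1 mulmx1.
Qed.

Lemma slope_sym V W Y :
    wronskian V V = 0 -> wronskian W W = 0 -> wronskian Y Y = 0 ->
    wronskian V W \in unitmx -> wronskian Y W \in unitmx ->
  (slope V W Y)^T = slope V W Y.
Proof.
move=> VV WW YY cu au; have := slope_diff VV WW cu au au.
by rewrite YY mulmx0 mul0mx => /esym/eqP; rewrite subr_eq0 => /eqP.
Qed.

Definition vertical : 'M[R]_(n + n, n) := col_mx 0 1%:M.

Lemma wronskian_vertical Y : wronskian vertical Y = - usubmx Y.
Proof.
by rewrite wronskianE /vertical col_mxKu col_mxKd trmx0 trmx1 mul0mx mul1mx sub0r.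
Qed.

Lemma frame_vertical : frame vertical.
Proof.
split; first by rewrite wronskian_vertical /vertical col_mxKu oppr0.
by rewrite /vertical rank_col_0mx mxrank1.
Qed.

(** This is [mu_index] with [a], [b] the Wronskians of [Y], [Z] with [W] and [k = usubmx W]. The
    difference of slopes is rewritten by [slope_diff] so that its symplectic invariance is
    visible. *)
Lemma mu_slope W Y Z :
    wronskian W W = 0 -> wronskian Y Y = 0 -> wronskian Z Z = 0 ->
    wronskian vertical W \in unitmx ->
    wronskian Y W \in unitmx -> wronskian Z W \in unitmx ->
  (mu Y Z + ind (- slope vertical W Y) =
   ind (invmx (wronskian Y W) *m wronskian Y Z *m (invmx (wronskian Z W))^T) +
   ind (- slope vertical W Z))%N.
Proof.
move=> WW YY ZZ cu au bu; have [VV _] := frame_vertical.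
have symY := slope_sym VV WW YY cu au; have symZ := slope_sym VV WW ZZ cu bu.
have D := slope_diff VV WW cu au bu; rewrite symY in D; rewrite D.
have usubE X : wronskian X W \in unitmx ->
    usubmx X = usubmx W *m slope vertical W X *m (wronskian X W)^T.
  move=> xu; rewrite /slope !wronskian_vertical.
  rewrite -!mulmxA -trmx_mul mulmxV // trmx1 mulmx1.
  rewrite wronskian_vertical in cu.
  by apply: oppr_inj; rewrite -[RHS]mulNmx mulKVmx.
apply: (mu_index symY symZ au bu _ (usubE _ au) (usubE _ bu)).
  by rewrite -[usubmx W]opprK -wronskian_vertical -scaleN1r unitmxZ // unitrN1.
rewrite -D !mulmxA mulmxV // mul1mx -mulmxA -trmx_mul mulmxV //.
by rewrite trmx1 mulmx1.
Qed.

(* For [W = (I; t I)] and [Y = (X; U)] one has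
   [w(Y, W) (- t X - U) = U^T U - t^2 X^T X], whose determinant is a polynomial
   in [t^2] that does not vanish at [t^2 = -1]. *)
Lemma exists_transversal (s : seq 'M[R]_(n + n, n)) :
    {in s, forall Y, frame Y} ->
  exists W, [/\ wronskian W W = 0, usubmx W = 1%:M &
                {in s, forall Y, wronskian Y W \in unitmx}].
Proof.
move=> frs.
pose r Y : {poly R} := \det (map_mx polyC ((dsubmx Y)^T *m dsubmx Y) -
                  'X *: map_mx polyC ((usubmx Y)^T *m usubmx Y)).
have rE Y t : (r Y).[t] =
    \det ((dsubmx Y)^T *m dsubmx Y - t *: ((usubmx Y)^T *m usubmx Y)).
  rewrite /r -horner_evalE -det_map_mx; congr (\det _).
  by apply/matrixP => i j; rewrite !mxE /= horner_evalE !hornerE.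
have r_neq0 Y : frame Y -> r Y != 0.
  (* At -1 the determinant is that of the Gram matrix [Y^T *m Y], invertible since [Y] has full
     column rank. *)
  move=> [_ rkY]; apply/eqP => r0; have := rE Y (-1); rewrite r0 horner0.
  rewrite scaleN1r opprK addrC -mul_row_col -tr_col_mx vsubmxK => /esym/eqP.
  apply/negP; rewrite -unitfE -unitmxE -{2}[Y]trmxK.
  by apply: row_free_gram_unit; rewrite /row_free mxrank_tr rkY.
pose p := \prod_(Y <- s) r Y.
have p_neq0 : p != 0.
  by rewrite prodf_seq_neq0; apply/allP => Y /frs /r_neq0.
have [t pt] : exists t : R, ~~ root p (t ^+ 2).
  (* These are [size p] distinct squares, more than [p] can have as roots. *)
  pose ts : seq R := [seq i%:R ^+ 2 | i <- iota 0 (size p)].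
  have ts_uniq : uniq ts.
    rewrite map_inj_uniq ?iota_uniq // => i j /eqP.
    by rewrite eqrXn2 ?ler0n // eqr_nat => /eqP.
  have := contraNN (fun x => max_poly_roots p_neq0 x ts_uniq).
  rewrite size_map size_iota ltnn => /(_ isT) /allPn [_ /mapP [i _ ->] pi].
  by exists i%:R.
exists (col_mx 1%:M t%:M); split.
- by rewrite wronskianE col_mxKu col_mxKd !tr_scalar_mx mulmx1 mul1mx subrr.
- by rewrite col_mxKu.
move=> Y Ys; have [YY _] := frs Y Ys.
rewrite wronskianE col_mxKu col_mxKd mulmx1 mul_mx_scalar.
set X := usubmx Y; set U := dsubmx Y.
have XU : X^T *m U = U^T *m X.
  by apply/eqP; rewrite -subr_eq0 -wronskianE YY.
have prod_unit : (t *: X^T - U^T) *m (- (t *: X) - U) \in unitmx.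
  have -> : (t *: X^T - U^T) *m (- (t *: X) - U) = U^T *m U - t ^+ 2 *: (X^T *m X).
    rewrite mulmxBr !mulmxBl !mulmxN -!scalemxAl -!scalemxAr scalerA XU -expr2.
    move: (X^T *m X) (U^T *m X) (U^T *m U) => a b c.
    by apply/matrixP => i j; rewrite !mxE; ring.
  rewrite unitmxE unitfE -rE; apply: contraNneq pt => rt.
  by rewrite /root /p (big_rem Y) //= hornerM rt mul0r.
by move: prod_unit; rewrite unitmx_mul => /andP [].
Qed.

End Wronskian.

(** * The antisymplectic reflection and the dual index *)

Section Flip.
Variables (R : rcfType) (n : nat).
Implicit Types Y Z : 'M[R]_(n + n, n).

Lemma pinvN p q (M : 'M[R]_(p, q)) : pinv (- M) = - pinv M.
Proof.
apply: (@penrose_uniq _ _ _ (- M)); first exact: pinvP.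
have /and4P [/eqP M1 /eqP M2 /eqP M3 /eqP M4] := pinvP M.
by apply/and4P; split; rewrite !(mulNmx, mulmxN, opprK) ?M1 ?M2 ?M3 ?M4.
Qed.

Definition flip : 'M[R]_(n + n) := block_mx 1%:M 0 0 (- 1%:M).

Lemma flipK : flip *m flip = 1%:M.
Proof.
rewrite /flip mulmx_block !(mulmx0, mul0mx, addr0, add0r) mulmx1.
by rewrite mulNmx mulmxN mulmx1 opprK -scalar_mx_block.
Qed.

Lemma trmx_flip : flip^T = flip.
Proof. by rewrite /flip tr_block_mx !trmx0 linearN /= trmx1. Qed.

Lemma flipJ : flip *m Jmx n *m flip = - Jmx n.
Proof.
rewrite /flip /Jmx !mulmx_block !(mulmx0, mul0mx, addr0, add0r, mulmx1, mul1mx).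
by rewrite !(mulNmx, mulmxN, mulmx1, mul1mx) opp_block_mx !oppr0 !opprK.
Qed.

Lemma wronskian_flip Y Z :
  wronskian (flip *m Y) (flip *m Z) = - wronskian Y Z.
Proof.
have -> : wronskian (flip *m Y) (flip *m Z) = Y^T *m (flip *m Jmx n *m flip) *m Z.
  by rewrite /wronskian trmx_mul trmx_flip !mulmxA.
by rewrite flipJ mulmxN mulNmx.
Qed.

Lemma usubmx_flip Y : usubmx (flip *m Y) = usubmx Y.
Proof.
by rewrite -{1}[Y]vsubmxK /flip mul_block_col col_mxKu mul1mx mul0mx addr0.
Qed.

Lemma frame_flip Y : frame Y -> frame (flip *m Y).
Proof.
move=> [YY rkY]; split; first by rewrite wronskian_flip YY oppr0.
have [flip_u _] := mulmx1_unit flipK.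
by rewrite -mxrank_tr trmx_mul mxrankMfree ?mxrank_tr // row_free_unit unitmx_tr.
Qed.

(** The reflection keeps upper blocks and negates Wronskians, so [ciM] and [ciP] change sign while
    [ciT] is fixed. *)
Lemma mu_dual_flip Y Z : mu_dual Y Z = mu (flip *m Y) (flip *m Z).
Proof.
have MN : ciM (flip *m Y) (flip *m Z) = - ciM Y Z.
  by rewrite /ciM usubmx_flip wronskian_flip mulmxN.
have TE : ciT (flip *m Y) (flip *m Z) = ciT Y Z.
  by rewrite /ciT MN pinvN mulNmx mulmxN opprK.
have PN : ciP (flip *m Y) (flip *m Z) = - ciP Y Z.
  by rewrite /ciP TE !usubmx_flip wronskian_flip linearN /= mulmxN !mulNmx.
by rewrite /mu_dual /mu MN PN mxrank_opp.
Qed.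

End Flip.

(** * Change of the comparative index under a symplectic map *)

Section Symplectic.
Variables (R : rcfType) (n : nat).
Implicit Types (S : 'M[R]_(n + n)) (Y Z : 'M[R]_(n + n, n)).

Lemma Jmx_unit : Jmx n \in @unitmx R (n + n).
Proof.
have : Jmx n *m (- Jmx n) = 1%:M :> 'M[R]_(n + n).
  rewrite mulmxN /Jmx mulmx_block !(mulmx0, mul0mx, addr0, add0r).
  by rewrite mulmx1 mul1mx opp_block_mx !oppr0 !opprK -scalar_mx_block.
by move/mulmx1_unit => [].
Qed.

Lemma symplectic_unit S : symplectic S -> S \in unitmx.
Proof.
by move=> SJ; have := Jmx_unit; rewrite -SJ unitmx_mul => /andP [].
Qed.

Lemma wronskian_symplectic S Y Z : symplectic S ->
  wronskian (S *m Y) (S *m Z) = wronskian Y Z.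
Proof. by move=> SJ; rewrite /wronskian trmx_mul -[in RHS]SJ !mulmxA. Qed.

Lemma frame_symplectic S Y : symplectic S -> frame Y -> frame (S *m Y).
Proof.
move=> SJ [YY rkY]; split; first by rewrite wronskian_symplectic.
have Su := symplectic_unit SJ.
by rewrite -mxrank_tr trmx_mul mxrankMfree ?mxrank_tr // row_free_unit unitmx_tr.
Qed.

Lemma wronskian_invmx S Y Z : symplectic S ->
  wronskian (invmx S *m Y) Z = wronskian Y (S *m Z).
Proof.
move=> SJ; rewrite -(wronskian_symplectic _ _ SJ) mulKVmx //.
exact: symplectic_unit.
Qed.

Lemma wronskian_invmx2 S Y Z : symplectic S ->
  wronskian (invmx S *m Y) (invmx S *m Z) = wronskian Y Z.
Proof.
move=> SJ; rewrite wronskian_invmx // mulKVmx //; exact: symplectic_unit.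
Qed.

Lemma wronskian_invmxr S Y Z : symplectic S ->
  wronskian Y (invmx S *m Z) = wronskian (S *m Y) Z.
Proof.
move=> SJ; rewrite -(wronskian_symplectic _ _ SJ) mulKVmx //.
exact: symplectic_unit.
Qed.

Lemma symplectic_flip S : symplectic S -> symplectic (flip R n *m S *m flip R n).
Proof.
move=> SJ; rewrite /symplectic !trmx_mul trmx_flip.
set f := flip R n.
have -> : f *m (S^T *m f) *m Jmx n *m (f *m S *m f) =
          f *m (S^T *m (f *m Jmx n *m f) *m S) *m f by rewrite !mulmxA.
by rewrite flipJ mulmxN mulNmx SJ mulmxN mulNmx flipJ opprK.
Qed.

Lemma invmx_flip S : symplectic S ->
  invmx (flip R n *m S *m flip R n) *m flip R n = flip R n *m invmx S.
Proof.
move=> SJ; have Su := symplectic_unit SJ.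
have fSu := symplectic_unit (symplectic_flip SJ).
apply: (can_inj (mulKmx fSu)); rewrite mulKVmx //.
by rewrite -!mulmxA (mulmxA (flip R n) (flip R n)) flipK mul1mx mulmxV // mulmx1.
Qed.

(* Both [mu Y Z] and [mu (S^-1 Y) (S^-1 Z)] are evaluated with one common plane
   [W], transversal to everything in sight: the term of [mu_slope] involving
   both [Y] and [Z] is symplectically invariant and cancels. *)
Lemma mu_coboundary S (s : seq 'M[R]_(n + n, n)) :
    symplectic S -> {in s, forall Y, frame Y} ->
  exists g : 'M[R]_(n + n, n) -> int, {in s &, forall Y Z,
    (mu Y Z)%:Z - (mu (invmx S *m Y) (invmx S *m Z))%:Z = g Z - g Y}.
Proof.
move=> SJ frs; have frV := frame_vertical R n.
(* Transversality of [W] to [S *m vertical R n] is that of [invmx S *m W] to the vertical plane,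
   needed for the slopes of the transformed frames. *)
have [|W [WW W1 Wu]] := @exists_transversal R n (S *m vertical R n :: s).
  by move=> Y; rewrite inE => /predU1P [->|/frs //]; apply: frame_symplectic.
exists (fun Y => (ind (- slope (vertical R n) W Y))%:Z -
  (ind (- slope (vertical R n) (invmx S *m W) (invmx S *m Y)))%:Z).
move=> Y Z Ys Zs; have [YY _] := frs Y Ys; have [ZZ _] := frs Z Zs.
have cu : wronskian (vertical R n) W \in unitmx.
  by rewrite wronskian_vertical W1 -scaleN1r unitmxZ ?unitmx1 // unitrN1.
have au := Wu Y (mem_behead (s := _ :: s) Ys).
have bu := Wu Z (mem_behead (s := _ :: s) Zs).
have eq1 := mu_slope WW YY ZZ cu au bu.
have := @mu_slope R n (invmx S *m W) (invmx S *m Y) (invmx S *m Z).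
rewrite !(wronskian_invmx2 _ _ SJ) wronskian_invmxr // => /(_ WW YY ZZ).
move=> /(_ (Wu _ (mem_head _ _)) au bu) eq2; move: eq1 eq2.
have arith (p q d x y x' y' : nat) : (p + x = d + y)%N -> (q + x' = d + y')%N ->
    p%:Z - q%:Z = (y%:Z - y'%:Z) - (x%:Z - x'%:Z) by lia.
exact: arith.
Qed.

End Symplectic.

(** * Cancellation of coboundaries in cyclic sums *)

Section CyclicSums.
Variables (m : nat) (f f' : nat -> nat -> nat) (g : nat -> int).
Hypotheses (m_gt0 : (0 < m)%N)
  (fg : forall k l, (1 <= k <= m)%N -> (1 <= l <= m)%N ->
    (f k l)%:Z - (f' k l)%:Z = g l - g k).

Lemma coboundary_telescope :
  (\sum_(1 <= k < m) f k k.+1)%N%:Z - (\sum_(1 <= k < m) f' k k.+1)%N%:Z =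
  g m - g 1%N.
Proof.
rewrite -(telescope_sumr g m_gt0) -!natz !natr_sum -sumrB.
by apply: eq_big_nat => k /andP [k1 km]; rewrite !natz fg //; lia.
Qed.

(** The chain telescopes to [g m - g 1], and the closing term contributes the opposite. *)
Lemma cyclic_sum_coboundary :
  (\sum_(1 <= k < m) f k k.+1 + f m 1)%N = (\sum_(1 <= k < m) f' k k.+1 + f' m 1)%N.
Proof. have := coboundary_telescope; have := @fg m 1%N; lia. Qed.

Lemma cyclic_diff_coboundary :
  (\sum_(1 <= k < m) f k k.+1)%N%:Z - (f 1 m)%:Z =
  (\sum_(1 <= k < m) f' k k.+1)%N%:Z - (f' 1 m)%:Z.
Proof. have := coboundary_telescope; have := @fg 1%N m; lia. Qed.

End CyclicSums.

Theorem proposition2p5 (R : realType) (n m : nat)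
  (Y : nat -> 'M[R]_(n + n, n)) (S : 'M[R]_(n + n))
  (hm : (2 <= m)%N)
  (hY : forall k : nat, (1 <= k <= m)%N -> frame (Y k))
  (hS : symplectic S) :
  [/\ mu_c_minus m Y = mu_c_minus m (fun k => invmx S *m Y k),
      mu_c_plus m Y = mu_c_plus m (fun k => invmx S *m Y k),
      nu_c_minus m Y = nu_c_minus m (fun k => invmx S *m Y k)
    & nu_c_plus m Y = nu_c_plus m (fun k => invmx S *m Y k)].
Proof.
have m_gt0 : (0 < m)%N by lia.
pose f := flip R n; pose s := [seq Y k | k <- iota 1 m].
have Ys k : (1 <= k <= m)%N -> Y k \in s.
  by move=> km; apply: map_f; rewrite mem_iota; lia.
have frs : {in s, forall Z, frame Z}.
  by move=> _ /mapP [k + ->]; rewrite mem_iota => km; apply: hY; lia.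
have [g gE] := mu_coboundary hS frs.
have frfs : {in [seq f *m Z | Z <- s], forall Z, frame Z}.
  by move=> _ /mapP [Z /frs frZ ->]; apply: frame_flip.
have [h hE] := mu_coboundary (symplectic_flip hS) frfs.
have mug k l : (1 <= k <= m)%N -> (1 <= l <= m)%N ->
    (mu (Y k) (Y l))%:Z - (mu (invmx S *m Y k) (invmx S *m Y l))%:Z =
    g (Y l) - g (Y k).
  by move=> /Ys Yk /Ys Yl; apply: gE.
have muh k l : (1 <= k <= m)%N -> (1 <= l <= m)%N ->
    (mu_dual (Y k) (Y l))%:Z - (mu_dual (invmx S *m Y k) (invmx S *m Y l))%:Z =
    h (f *m Y l) - h (f *m Y k).
  (* Flipping a transformed frame amounts to transforming the flipped frame by the conjugate
     symplectic matrix, so [hE] covers the dual index. *)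
  have fS Z : f *m (invmx S *m Z) = invmx (f *m S *m f) *m (f *m Z).
    by rewrite [LHS]mulmxA -(invmx_flip hS) -[LHS]mulmxA.
  move=> /Ys Yk /Ys Yl; rewrite !mu_dual_flip !fS.
  exact: (hE _ _ (map_f _ Yk) (map_f _ Yl)).
split.
- exact: (cyclic_sum_coboundary m_gt0 mug).
- exact: (cyclic_sum_coboundary m_gt0 muh).
- exact: (cyclic_diff_coboundary m_gt0 mug).
- exact: (cyclic_diff_coboundary m_gt0 muh).
Qed.
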